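(* (i) If $S$ is a finite s-indecomposable semigroup and $Y$ is a subsemilattice of $S$, then $$|Y|\leq 2\left\lfloor\frac{|S|-1}{4}\right\rfloor+1.$$ (ii) For every positive integer $n$ there is an s-indecomposable semigroup $S$ with $|S|=n$ that has a subsemilattice $Y$ with $$|Y|= 2\left\lfloor\frac{|S|-1}{4}\right\rfloor+1.$$
   Context: Semigroups are nonempty. A semilattice is a commutative semigroup all of whose elements are idempotent; a subsemilattice of a semigroup $S$ is a subsemigroup of $S$ that is a semilattice. A semigroup $S$ is semilattice indecomposable (s-indecomposable) if every semilattice homomorphic image of $S$ is trivial, i.e. has exactly one element. *)

(* Defs.v *)
From HB Require Import structures.
From mathcomp Require Import all_boot.

Set Implicit Arguments.
Unset Strict Implicit.
Unset Printing Implicit Defensive.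

Local Open Scope group_scope.

(* Inherited from semigroupType, the carrier may be empty: nonemptiness is
   always required separately. *)
#[short(type="finSemigroupType")]
HB.structure Definition FinSemigroup := {G of Semigroup G & Finite G}.

Definition is_semilattice (L : semigroupType) : Prop :=
  commutative (@mul L) /\ idempotent_op (@mul L).

Definition is_subsemilattice (S : finSemigroupType) (Y : {set S}) : Prop :=
  [/\ Y != set0,
      mulg_closed Y,
      {in Y &, forall x y : S, x * y = y * x}
    & {in Y, forall x : S, x * x = x}].

(* A homomorphic image is the codomain of a surjective homomorphism. The library
   requires a choiceType carrier, which classically excludes no semigroup. *)
Definition s_indecomposable (S : semigroupType) : Prop :=
  forall (L : semigroupType) (f : {multiplicative S -> L}),
    is_semilattice L -> (forall y : L, exists x : S, f x = y) ->
    exists! y : L, True.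

(* Main.v *)
Require Import Defs.
From HB Require Import structures.
From mathcomp Require Import all_boot.

(** Upper bound. For an idempotent [e], the complement of [F], the set of the
divisors of [e], is an ideal. If [F] were a proper subset closed under products,
its indicator would be a homomorphism onto the two-element semilattice. Hence,
in an s-indecomposable semigroup, either every element divides [e], i.e. [e]
lies in the kernel (the least ideal), or two divisors of [e] have a product
outside [F].

The J-class of [e] is then large for two reasons, both instances of one count,
[square_leq_jclass]. Factorizations [l i * r i = e] give idempotents
[r i * l i] of the J-class; if these are pairwise neither R-equivalent nor
L-equivalent, then the [r i * l j] are pairwise distinct elements of the J-class.
- Outside the kernel, the two divisors with an escaping product supply two such
  idempotents, so the J-class has at least 4 elements ([leq4_jclass]).
- In a finite semigroup an idempotent is never a multiple of a strictly smaller
  one ([idem_below_eq]). So every idempotent of the J-class arises from such a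
  factorization, and commuting ones are R- or L-equivalent only if equal: if [m]
  elements of the subsemilattice lie in the J-class, it has at least [m ^ 2]
  elements ([sqr_card_jclass_semilattice]).

Together a J-class outside the kernel that contains [m > 0] elements of the
subsemilattice has at least [4 * uphalf m] elements. The kernel contains at most
one element of the subsemilattice ([kernel_semilattice_le1]) and is nonempty, so
the other J-classes fill at most [#|S| - 1] elements. Summing over the J-classes
gives the bound.

Attaining it. A Brandt semigroup of order 5 consists of zero and of the four
2 x 2 matrix units, and its idempotents form a subsemilattice of order 3. Gluing
[k] of them at zero, together with [r < 4] elements whose products all vanish,
gives order [4 * k + r + 1] and a subsemilattice of order [2 * k + 1]. A
homomorphism to a semilattice sends every element of square zero where it sends
zero, and every matrix unit is a product with a factor of square zero, so the
homomorphism is constant. *)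

Set Implicit Arguments.
Unset Strict Implicit.
Unset Printing Implicit Defensive.

Local Open Scope group_scope.

(** The two-element semilattice, target of the indicator of a prime filter. *)
HB.instance Definition _ := isSemigroup.Build bool andbA.

(** * Divisors and J-classes of idempotents *)

Section JClasses.

Variable S : finSemigroupType.
Implicit Types (e f g x y z : S) (Y : {set S}).

(** Two-sided divisibility without adjoining an identity. It is reflexive only at
some elements, idempotents among them. *)
Definition divides x y := [exists u, exists v, y == u * x * v].

(** This is the J-class of [e] when [e] is idempotent, the only case in use. *)
Definition jclass e := [set x | divides x e && divides e x].

Lemma dividesP x y : reflect (exists u v, y = u * x * v) (divides x y).
Proof.
apply: (iffP existsP) => [[u /existsP[v /eqP ->]]|[u [v ->]]]; first by exists u, v.
by exists u; apply/existsP; exists v.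
Qed.

Lemma divides_trans y x z : divides x y -> divides y z -> divides x z.
Proof.
move=> /dividesP[u [v ->]] /dividesP[s [t ->]].
by apply/dividesP; exists (s * u), (v * t); rewrite !mulgA.
Qed.

Lemma divides_idem e : e * e = e -> divides e e.
Proof. by move=> ee; apply/dividesP; exists e, e; rewrite !ee. Qed.

Lemma divides_mull x y z : divides (x * y) z -> divides x z.
Proof.
by move=> /dividesP[u [v ->]]; apply/dividesP; exists u, (y * v); rewrite !mulgA.
Qed.

Lemma divides_mulr x y z : divides (x * y) z -> divides y z.
Proof.
by move=> /dividesP[u [v ->]]; apply/dividesP; exists (u * x), v; rewrite !mulgA.
Qed.

Lemma mem_jclass e : e * e = e -> e \in jclass e.
Proof. by move=> ee; rewrite inE divides_idem. Qed.

Lemma jclass_eq e f x : x \in jclass e -> x \in jclass f -> jclass e = jclass f.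
Proof.
rewrite !inE => /andP[xe ex] /andP[xf fx].
have fe := divides_trans fx xe; have ef := divides_trans ex xf.
apply/setP=> y; rewrite !inE; apply/andP/andP => -[].
  by move=> /divides_trans/(_ ef) ? /(divides_trans fe).
by move=> /divides_trans/(_ fe) ? /(divides_trans ef).
Qed.

(** A product in which every element of the semigroup is a factor lies in the
kernel; it is what makes the kernel nonempty. *)
Lemma exists_common_multiple x0 : exists z, forall x, divides x z.
Proof.
suff [z Hz] : exists z, forall x, x \in enum S -> divides x z.
  by exists z => x; apply: Hz; rewrite mem_enum.
elim: (enum S) => [|x s [z Hz]]; first by exists x0.
exists (z * x * z) => y; rewrite inE => /predU1P[->|/Hz /dividesP[u [v zE]]].
  by apply/dividesP; exists z, z.
by apply/dividesP; exists (z * x * u), v; rewrite {2}zE !mulgA.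
Qed.

(** Left multiplication by [v] is injective on the right ideal [e * S], since [u]
undoes it; as [S] is finite it is onto, so [e = v * w] for some [w] in [e * S],
and cancelling [v] gives [u * e = w]. *)
Lemma one_sided_inverse e u v :
  e * e = e -> e * v = v -> u * v = e -> v * (u * e) = e.
Proof.
move=> ee ev uv.
pose A := [set x | e * x == x].
have eA : e \in A by rewrite inE ee.
have vinj : {in A &, injective (mul v)}.
  move=> x y; rewrite !inE => /eqP ex /eqP ey vxy.
  by rewrite -ex -ey -uv -!mulgA vxy.
have imA : [set v * x | x in A] = A.
  apply/eqP; rewrite eqEcard card_in_imset // leqnn andbT.
  by apply/subsetP=> _ /imsetP[x _ ->]; rewrite inE mulgA ev.
(* As [v * _] permutes [e * S], it takes the value [e] there. *)
move: (eA); rewrite -imA => /imsetP[w]; rewrite inE => /eqP ew eE.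
by rewrite {1}eE (mulgA u) uv ew -eE.
Qed.

(** Stability of finite semigroups. If [f = x * g * y], then [x] is a left inverse
of [g * y] with respect to [f], hence also a right inverse: [f] lies in [g * S]. *)
Lemma idem_below_eq f g : f * f = f -> g * g = g -> f * g = g -> g * f = g ->
  divides g f -> f = g.
Proof.
move=> ff gg fg gf /dividesP[x [y fE]].
have fv : f * (g * y) = g * y by rewrite mulgA fg.
have uv : x * (g * y) = f by rewrite mulgA.
have fE' := one_sided_inverse ff fv uv.
by rewrite -gf -{2}fE' !mulgA gg -(mulgA _ x) fE'.
Qed.

(** Write [f i] for [r i * l i]. Multiplying [r i * l j] on the right by
[r j * l i] gives back [f i], so [r i * l j] is R-equivalent to [f i]; likewise it
is L-equivalent to [f j]. The last two hypotheses say that distinct [f i] are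
neither R-equivalent nor L-equivalent, so [r i * l j] determines [i] and [j]. *)
Lemma square_leq_jclass (I : finType) e (l r : I -> S) :
    (forall i, l i * r i = e) ->
    (forall i, e * l i = l i) -> (forall i, r i * e = r i) ->
    (forall i j, r i * l i * (r j * l j) = r j * l j ->
                 r j * l j * (r i * l i) = r i * l i -> i = j) ->
    (forall i j, r i * l i * (r j * l j) = r i * l i ->
                 r j * l j * (r i * l i) = r j * l j -> i = j) ->
  (#|I| ^ 2 <= #|jclass e|)%N.
Proof.
move=> lr el re neqR neqL.
have rlr i j k : r i * l j * (r j * l k) = r i * l k.
  by rewrite !mulgA -(mulgA (r i)) lr re.
pose h (p : I * I) := r p.1 * l p.2.
have hinj : injective h.
  have absR i j k m : r i * l j = r k * l m ->
      r k * l k * (r i * l i) = r i * l i.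
    by move=> hE; rewrite -(rlr i j i) hE mulgA rlr.
  have absL i j k m : r i * l j = r k * l m ->
      r j * l j * (r m * l m) = r j * l j.
    by move=> hE; rewrite -{1}(rlr j i j) hE -mulgA rlr -hE rlr.
  move=> [i j] [k m]; rewrite /h /= => hE; have hE' := esym hE.
  by rewrite (neqR i k (absR _ _ _ _ hE') (absR _ _ _ _ hE))
             (neqL j m (absL _ _ _ _ hE) (absL _ _ _ _ hE')).
rewrite -mulnn -card_prod -(card_imset _ hinj).
apply/subset_leq_card/subsetP => _ /imsetP[[i j] _ ->]; rewrite inE /h /=.
have ee : e * e = e by rewrite -{1}(lr i) -mulgA re lr.
apply/andP; split; apply/dividesP.
  by exists (l i), (r j); rewrite mulgA lr -mulgA lr ee.
by exists (r i), (l j); rewrite re.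
Qed.

(** J-equivalent idempotents of a finite semigroup are D-equivalent. From
[e = x * f * y] one gets [l] and [r] with [l * r = e] and [r * l] an idempotent
below [f]; since [f] is a multiple of [e], stability forces [r * l = f]. *)
Lemma idem_jclass_pair e f : e * e = e -> f * f = f -> f \in jclass e ->
  exists lr : S * S, [/\ lr.1 * lr.2 = e, lr.2 * lr.1 = f,
                         e * lr.1 = lr.1 & lr.2 * e = lr.2].
Proof.
move=> ee ff; rewrite inE => /andP[/dividesP[x [y eE]] /dividesP[s [t fE]]].
pose l := e * x * f; pose r := f * y * e.
have lr : l * r = e.
  by rewrite /l /r -!mulgA (mulgA f f) ff (mulgA x) (mulgA (x * f)) -eE !ee.
have el : e * l = l by rewrite /l !mulgA ee.
have re : r * e = r by rewrite /r -!mulgA ee.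
have fr : f * r = r by rewrite /r !mulgA ff.
have lf : l * f = l by rewrite /l -!mulgA ff.
clearbody l r; exists (l, r); split=> //=; apply/esym/idem_below_eq => //.
- by rewrite -mulgA (mulgA l) lr mulgA re.
- by rewrite mulgA fr.
- by rewrite -mulgA lf.
apply/dividesP; exists (s * l), (r * t).
by rewrite -!mulgA !(mulgA l r) lr (mulgA e e) ee mulgA.
Qed.

(** * J-classes of an s-indecomposable semigroup *)

Definition in_kernel e := [forall x, divides x e].

Hypothesis S_indec : s_indecomposable S.

(** Otherwise dividing [e] would be a multiplicative predicate, i.e. a homomorphism
onto the two-element semilattice. *)
Lemma exists_escaping_product e : e * e = e -> ~~ in_kernel e ->
  exists a b, [/\ divides a e, divides b e & ~~ divides (a * b) e].
Proof.
move=> ee /forallPn[z Nz].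
have [/forallP closed | /forallPn[a /forallPn[b]]] :=
    boolP [forall a, forall b, divides a e && divides b e ==> divides (a * b) e];
  last by rewrite negb_imply => /andP[/andP[ae be] Nab]; exists a, b.
have dM : {morph divides^~ e : a b / a * b >-> a && b}.
  move=> a b; apply/idP/idP => [abe|].
    by rewrite (divides_mull abe) (divides_mulr abe).
  by apply/implyP; apply/forallP: b; apply: closed.
pose h : {multiplicative S -> bool} :=
  HB.pack (divides^~ e) (isMultiplicative.Build S bool (divides^~ e) dM).
have [||b [_ uniq_b]] := @S_indec _ h.
- by split=> [a b|[]]; rewrite // [LHS]andbC.
- by case; [exists e; apply: divides_idem | exists z; apply/negbTE].
by have := uniq_b true I; rewrite (uniq_b false I).
Qed.

(** From [e = x * a * y = u * b * v], the idempotents [p = y * e * x * a] and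
[q = b * v * e * u] lie in the J-class of [e], while [p * q] is a multiple of
[a * b] and escapes from it. Being R- or L-equivalent would force [p * q] to be
[p] or [q]. *)
Lemma leq4_jclass e : e * e = e -> ~~ in_kernel e -> (4 <= #|jclass e|)%N.
Proof.
move=> ee /(exists_escaping_product ee)[a [b [ae be Nab]]].
have /dividesP[x [y eE]] := ae; have /dividesP[u [v eE']] := be.
pose l (c : bool) := if c then e * x * a else e * u.
pose r (c : bool) := if c then y * e else b * v * e.
have lr c : l c * r c = e.
  case: c; rewrite /l /r -!mulgA.
    by rewrite (mulgA x) (mulgA (x * a)) -eE !ee.
  by rewrite (mulgA u) (mulgA (u * b)) -eE' !ee.
have el c : e * l c = l c by case: c; rewrite /l !mulgA ee.
have re c : r c * e = r c by case: c; rewrite /r -!mulgA ee.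
have Npq : ~~ divides (r true * l true * (r false * l false)) e.
  apply: contra Nab => pqe.
  have abpq : divides (a * b) (r true * l true * (r false * l false)).
    apply/dividesP; exists (y * e * e * x), (v * e * e * u).
    by rewrite /l /r !mulgA.
  exact: divides_trans abpq pqe.
have fe c : divides (r c * l c) e.
  by apply/dividesP; exists (l c), (r c); rewrite mulgA lr -mulgA lr ee.
have := square_leq_jclass lr el re; rewrite card_bool; apply=> -[] [] //.
- by move=> pq _; rewrite pq fe in Npq.
- by move=> _ pq; rewrite pq fe in Npq.
- by move=> pq _; rewrite pq fe in Npq.
- by move=> _ pq; rewrite pq fe in Npq.
Qed.

(** * The upper bound *)

Section Subsemilattice.

Variable Y : {set S}.
Hypothesis Y_sl : is_subsemilattice Y.

Let Y_idem e : e \in Y -> e * e = e.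
Proof. by case: Y_sl => _ _ _; apply. Qed.

Let Y_comm : {in Y &, forall e f, e * f = f * e}.
Proof. by case: Y_sl. Qed.

(** Commuting idempotents that are R-equivalent or L-equivalent are equal. *)
Lemma sqr_card_jclass_semilattice e : e \in Y ->
  (#|Y :&: jclass e| ^ 2 <= #|jclass e|)%N.
Proof.
move=> Ye; have ee := Y_idem Ye; set A := Y :&: jclass e.
have /fin_all_exists[lr lrP] (i : {f | f \in A}) : exists lr : S * S,
    [/\ lr.1 * lr.2 = e, lr.2 * lr.1 = val i, e * lr.1 = lr.1 & lr.2 * e = lr.2].
  case: i => f /=; rewrite inE => /andP[Yf Jf].
  exact: idem_jclass_pair (Y_idem Yf) Jf.
have AY (i : {f | f \in A}) : val i \in Y by case: i => f /= /setIP[].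
rewrite -card_sig.
apply: (@square_leq_jclass _ e (fun i => (lr i).1) (fun i => (lr i).2))
  => [i|i|i|i j|i j].
- by case: (lrP i).
- by case: (lrP i).
- by case: (lrP i).
- have [_ -> _ _] := lrP i; have [_ -> _ _] := lrP j.
  by rewrite Y_comm // => -> /val_inj.
- have [_ -> _ _] := lrP i; have [_ -> _ _] := lrP j.
  by rewrite Y_comm // => -> /val_inj.
Qed.

(** If [e] is in the kernel then [e * f], an idempotent below [e], divides [e], so
that stability gives [e = e * f]. *)
Lemma kernel_semilattice_le1 : (#|[set e in Y | in_kernel e]| <= 1)%N.
Proof.
suff below e f : e \in Y -> f \in Y -> in_kernel e -> e = e * f.
  apply/card_le1_eqP => e f; rewrite !inE => /andP[Ye Ke] /andP[Yf Kf].
  by rewrite [LHS](below f e) // [RHS](below e f) // Y_comm.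
move=> Ye Yf /forallP Ke; have [ee ff] := (Y_idem Ye, Y_idem Yf).
apply: idem_below_eq => //.
- by rewrite -mulgA (mulgA f) -(Y_comm Ye Yf) -mulgA ff mulgA ee.
- by rewrite mulgA ee.
- by rewrite -mulgA -(Y_comm Ye Yf) mulgA ee.
Qed.

Lemma card_subsemilattice_le :
  (#|Y| <= 2 * ((#|S| - 1) %/ 4) + 1)%N.
Proof.
have /set0Pn[y0 _] : Y != set0 by case: Y_sl.
have [z zP] := exists_common_multiple y0.
pose N := [set e in Y | ~~ in_kernel e].
pose P := [set jclass e | e in N].
have PE D : D \in P -> exists e, [/\ e \in Y, ~~ in_kernel e & D = jclass e].
  by move=> /imsetP[e]; rewrite inE => /andP[Ye Ke] ->; exists e.
have trivP : trivIset P.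
  apply/trivIsetP => _ _ /PE[e [Ye _ ->]] /PE[f [Yf _ ->]].
  apply: contraR => /pred0Pn[x /andP[/= xe xf]].
  by apply/eqP; apply: jclass_eq xe xf.
(* The kernel element [z] is outside all these classes: whatever divides [z]
   divides every element that [z] divides. *)
have cover_lt : (#|cover P| <= #|S| - 1)%N.
  rewrite subn1 -(cardsC1 z); apply/subset_leq_card/subsetP=> x.
  move=> /bigcupP[D /PE[e [Ye Ke ->]] xe]; rewrite !inE.
  apply: contra Ke => /eqP xz; move: xe; rewrite xz inE => /andP[ze _].
  by apply/forallP => t; apply: divides_trans (zP t) ze.
have class_le D : D \in P -> (4 * uphalf #|Y :&: D| <= #|D|)%N.
  move=> /PE[e [Ye Ke ->]].
  have := leq4_jclass (Y_idem Ye) Ke; have := sqr_card_jclass_semilattice Ye.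
  move: #|jclass e| #|_ :&: _| => d [|[|[|m]]] //= md d4.
  (* For one or two idempotents the bound 4 suffices; from three on, the square
     takes over. *)
  have half : (2 * uphalf m.+3 <= m.+4)%N.
    by rewrite mul2n -[leqRHS](odd_double_half m.+4) leq_addl.
  apply: leq_trans md; rewrite -[4%N]/(2 * 2)%N -mulnA.
  apply: leq_trans (leq_mul (leqnn 2) half) _; rewrite -mulnn.
  have three_le : (2 < m.+3)%N by [].
  apply: leq_trans (leq_mul three_le (leqnn m.+3)).
  by rewrite mulnS (mulSn 2) leq_add2r.
have NE : (#|N| <= \sum_(D in P) #|Y :&: D|)%N.
  rewrite -sum1_card (partition_big_imset jclass) /= leq_sum // => D PD.
  rewrite sum1_card; apply/subset_leq_card/subsetP=> e /andP[].
  rewrite !inE => /andP[Ye _] /eqP <-.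
  by rewrite Ye mem_jclass // Y_idem.
have YE : (#|Y| <= #|N| + 1)%N.
  rewrite -(cardsID [set e | in_kernel e] Y) addnC leq_add //.
    by apply/subset_leq_card/subsetP=> e; rewrite !inE andbC.
  apply: leq_trans kernel_semilattice_le1.
  by apply/subset_leq_card/subsetP=> e; rewrite !inE.
apply: leq_trans YE _; rewrite leq_add2r (leq_trans NE) //.
have sum_le : (\sum_(D in P) uphalf #|Y :&: D| <= (#|S| - 1) %/ 4)%N.
  rewrite leq_divRL // (leq_trans _ cover_lt) // -(eqP trivP) mulnC big_distrr.
  exact: leq_sum.
apply: leq_trans (leq_mul (leqnn 2) sum_le); rewrite big_distrr leq_sum //= => D _.
by rewrite mul2n -leq_uphalf_double.
Qed.

End Subsemilattice.

End JClasses.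

(** * Semigroups attaining the bound *)

(** The 0-direct union of [k] Brandt semigroups of order 5 and a null semigroup:
[None] is zero, [(i, (a, b))] is the matrix unit at [(a, b)] in the [i]-th copy,
and ['I_r] indexes the nonzero null elements. *)
Definition brandt_sum (k r : nat) := option ('I_k * (bool * bool) + 'I_r).

HB.instance Definition _ k r := Finite.on (brandt_sum k r).

Section BrandtSum.

Variables k r : nat.
Implicit Types x y z : brandt_sum k r.

Definition brandt_unit (i : 'I_k) a b : brandt_sum k r := Some (inl (i, (a, b))).

Definition brandt_mul x y : brandt_sum k r :=
  match x, y with
  | Some (inl (i, (a, b))), Some (inl (j, (c, d))) =>
      if (i == j) && (b == c) then brandt_unit i a d else None
  | _, _ => None
  end.

Lemma brandt_mulA : associative brandt_mul.
Proof.
case=> [[[i [a b]]|p]|] [[[j [c d]]|q]|] [[[m [e f]]|s]|] //=; try by case: ifP.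
case: (eqVneq i j) => [<-|/negPf ij] /=; last by case: ifP => //= _; rewrite ij.
case: (eqVneq i m) => [<-|/negPf im] /=; last by case: ifP => //= _; rewrite im.
by case: b c d e => [] [] [] [] /=; rewrite ?eqxx.
Qed.

HB.instance Definition _ := isSemigroup.Build (brandt_sum k r) brandt_mulA.

Lemma brandt_unitM i a b j c d :
  brandt_unit i a b * brandt_unit j c d =
  if (i == j) && (b == c) then brandt_unit i a d else None.
Proof. by []. Qed.

Lemma brandt_sum_s_indecomposable : s_indecomposable (brandt_sum k r).
Proof.
move=> L f [LC LI] f_surj; exists (f None); split=> // y _.
have [x <-] := f_surj y; symmetry.
have f_nil z : z * z = None -> f z = f None by move=> zz; rewrite -zz gmulfM LI.
case: x => [[[i [a b]]|p]|]; [| exact: f_nil | by []].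
have -> : Some (inl (i, (a, b))) = brandt_unit i a (~~ a) * brandt_unit i (~~ a) b.
  by rewrite brandt_unitM !eqxx.
rewrite gmulfM (f_nil (brandt_unit _ _ _)).
  by rewrite -gmulfM.
by rewrite brandt_unitM eqxx; case: a.
Qed.

Lemma card_brandt_sum : #|{: brandt_sum k r}| = (4 * k + r).+1.
Proof. by rewrite card_option card_sum !card_prod card_bool !card_ord mulnC. Qed.

(** The idempotents of [brandt_sum k r]. *)
Definition brandt_diag (o : option ('I_k * bool)) : brandt_sum k r :=
  omap (fun p => inl (p.1, (p.2, p.2))) o.

Lemma brandt_diag_inj : injective brandt_diag.
Proof. by move=> [[i a]|] [[j b]|] //= [-> ->]. Qed.

Lemma brandt_diagM o p :
  brandt_diag o * brandt_diag p = brandt_diag (if o == p then o else None).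
Proof.
case: o p => [[i a]|] [[j b]|] //.
have -> : (Some (i, a) == Some (j, b)) = (i == j) && (a == b) by [].
by rewrite brandt_unitM /=; case: ifP => // /andP[_ /eqP ->].
Qed.

Lemma brandt_diag_subsemilattice :
  is_subsemilattice [set brandt_diag o | o : option ('I_k * bool)].
Proof.
split.
- by apply/set0Pn; exists (brandt_diag None); apply: imset_f.
- by move=> _ _ /imsetP[o _ ->] /imsetP[p _ ->]; rewrite brandt_diagM imset_f.
- move=> _ _ /imsetP[o _ ->] /imsetP[p _ ->]; rewrite !brandt_diagM eq_sym.
  by case: eqP => // ->.
- by move=> _ /imsetP[o _ ->]; rewrite brandt_diagM eqxx.
Qed.

Lemma card_brandt_diag :
  #|[set brandt_diag o | o : option ('I_k * bool)]| = (2 * k + 1)%N.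
Proof.
rewrite card_imset; last exact: brandt_diag_inj.
by rewrite card_option card_prod card_ord card_bool mulnC addn1.
Qed.

End BrandtSum.

Theorem theorem5p2 :
  (forall (S : finSemigroupType) (Y : {set S}),
      (0 < #|S|)%N -> s_indecomposable S -> is_subsemilattice Y ->
      (#|Y| <= 2 * ((#|S| - 1) %/ 4) + 1)%N)
  /\
  (forall n : nat, (0 < n)%N ->
     exists (S : finSemigroupType) (Y : {set S}),
       [/\ #|S| = n, s_indecomposable S, is_subsemilattice Y
         & #|Y| = (2 * ((#|S| - 1) %/ 4) + 1)%N]).
Proof.
split=> [S Y _ S_indec Y_sl|[//|n] _]; first exact: card_subsemilattice_le.
have cardS : #|{: brandt_sum (n %/ 4) (n %% 4)}| = n.+1.
  by rewrite card_brandt_sum mulnC -divn_eq.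
exists (brandt_sum (n %/ 4) (n %% 4)),
  [set brandt_diag _ o | o : option ('I_(n %/ 4) * bool)].
rewrite card_brandt_diag cardS subn1; split=> //.
  exact: brandt_sum_s_indecomposable.
exact: brandt_diag_subsemilattice.
Qed.
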